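(* (Stability) Let $T>0$ be fixed. Let $V(x,\tau),W(x,\tau)$ be two smooth functions on $[0,2\pi]\times[0,T]$, $2\pi$-periodic in $x$; let $V^N(\tau)=I_N(V(\tau))$, $W^N(\tau)=I_N(W(\tau))$, and let $F^N(\cdot,\tau),G^N(\cdot,\tau)\in S_N$ be the trigonometric polynomials such that for $j=0,\dots,2N-1$ and $\tau\in[0,T]$ $$F^N(x_j,\tau)=\Big[\frac{\partial V^N}{\partial\tau}-A\frac{\partial^2V^N}{\partial x^2}-B\frac{\partial V^N}{\partial x}-C\Big(\frac{\partial V^N}{\partial x}\Big)^2\Big](x_j,\tau),$$ $$G^N(x_j,\tau)=\Big[\frac{\partial W^N}{\partial\tau}-A\frac{\partial^2W^N}{\partial x^2}-B\frac{\partial W^N}{\partial x}-C\Big(\frac{\partial W^N}{\partial x}\Big)^2\Big](x_j,\tau).$$ Let $M\ge0$ be such that $$\|(V^N)_x(\tau)\|_\infty\le M,\qquad \|(W^N)_x(\tau)\|_\infty\le M,\qquad \tau\in[0,T].$$ Then there exists a constant $R=R(M)$ (depending on $M$ and the fixed data $T,A,B,C$, but not on $N$) such that $$\max_{0\le\tau\le T}\|e^N(\tau)\|^2+\frac A2\int_0^T\|e^N_x(\tau)\|^2d\tau\le R\Big(\|e^N(0)\|^2+\int_0^T\|J^N(\tau)\|^2d\tau\Big),$$ where $e^N(\tau)=V^N(\tau)-W^N(\tau)$ and $J^N(\tau)=F^N(\tau)-G^N(\tau)$.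
   Context: For $N\in\mathbb N$ ($N\ge1$), $S_N=\mathrm{span}\{e^{ikx}:-N\le k\le N-1\}$, with nodes $x_j=j\pi/N$, $j=0,\dots,2N-1$. $I_N(u)\in S_N$ denotes the trigonometric interpolant of $u$ at these nodes: $I_N(u)=\sum_{k=-N}^{N-1}\hat u_ke^{ikx}$, $\hat u_k=\frac1{2N}\sum_{j=0}^{2N-1}u(x_j)e^{-ikx_j}$. $\|\cdot\|$ is the $L^2(0,2\pi)$ norm (complex-valued functions) and $\|u\|_\infty=\sup_{0\le x\le2\pi}|u(x)|$. $u(\tau)$ denotes $u(\cdot,\tau)$; subscript $x$ denotes $\partial/\partial x$. The constants are $A=C=\kappa^2\frac{\sigma^2}2>0$ and $B=\kappa\left(\alpha-\frac{\sigma^2}2\right)$, with $\kappa=\frac{2\pi}{4\hat x_{\max}-4\hat x_{\min}}$, where $\alpha\in\mathbb R$, $\sigma>0$ and $\hat x_{\min}<\hat x_{\max}$ are fixed reals. *)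

(* Defs.v *)
From Stdlib Require Import Reals ZArith.
From Coquelicot Require Import Coquelicot.
Open Scope R_scope.

Definition kappa_of (xmin xmax : R) : R := 2 * PI / (4 * xmax - 4 * xmin).

(** [expi k x] is [e^{ikx}]. *)
Definition expi (k : Z) (x : R) : C := (cos (IZR k * x), sin (IZR k * x)).

Definition node (N j : nat) : R := INR j * PI / INR N.

(** The frequencies [-N <= k <= N-1] are enumerated as [freq N m],
    [0 <= m <= 2N-1].  Note that [sum_n a n] has [n+1] terms. *)
Definition freq (N m : nat) : Z := (Z.of_nat m - Z.of_nat N)%Z.

Definition in_S (N : nat) (u : R -> C) : Prop :=
  exists c : Z -> C, forall x : R,
    u x = sum_n (fun m => (c (freq N m) * expi (freq N m) x)%C) (2 * N - 1).

Definition dft (N : nat) (u : R -> C) (k : Z) : C :=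
  (RtoC (/ (2 * INR N)) *
   sum_n (fun j => u (node N j) * expi (- k) (node N j)) (2 * N - 1))%C.

Definition interp (N : nat) (u : R -> C) (x : R) : C :=
  sum_n (fun m => (dft N u (freq N m) * expi (freq N m) x)%C) (2 * N - 1).

(** Only applied to continuous functions, for which the Riemann and Lebesgue
    integrals agree. *)
Definition L2norm (u : R -> C) : R :=
  sqrt (RInt (fun x => Cmod (u x) ^ 2) 0 (2 * PI)).

Definition sup_norm (u : R -> C) : Rbar :=
  Lub_Rbar (fun r => exists x, 0 <= x <= 2 * PI /\ r = Cmod (u x)).

(** Derivative of a complex-valued function on the line (componentwise). *)
Definition CDerive (u : R -> C) (x : R) : C :=
  (Derive (fun y => fst (u y)) x, Derive (fun y => snd (u y)) x).

(** Derivative at [t] relative to [[a, b]]: two-sided in the interior,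
    one-sided at the endpoints.  This is [is_derive] with [locally t]
    restricted to [[a, b]]. *)
Definition is_derive_on (a b : R) (f : R -> C) (t : R) (l : C) : Prop :=
  filterdiff (K := R_AbsRing) (U := R_NormedModule) (V := C_R_NormedModule)
    f (within (fun s => a <= s <= b) (locally t)) (fun h => scal h l).

Definition rect (T : R) (p : R * R) : Prop :=
  0 <= fst p <= 2 * PI /\ 0 <= snd p <= T.

(** [V] is C-infinity on the closed rectangle [[0,2pi] x [0,T]]: [D i j] is
    the partial derivative of order [i] in [x] and [j] in [tau]. *)
Definition smooth (T : R) (V : R -> R -> C) : Prop :=
  exists D : nat -> nat -> R -> R -> C,
    (forall x tau, rect T (x, tau) -> D 0%nat 0%nat x tau = V x tau) /\
    forall i j,
      continuous_on (rect T) (fun p : R * R => D i j (fst p) (snd p)) /\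
      forall x tau, rect T (x, tau) ->
        is_derive_on 0 (2 * PI) (fun y => D i j y tau) x (D (S i) j x tau) /\
        is_derive_on 0 T (fun s => D i j x s) tau (D i (S j) x tau).

Definition periodic_x (T : R) (V : R -> R -> C) : Prop :=
  forall x tau, 0 <= tau <= T -> V (x + 2 * PI) tau = V x tau.

Definition interp_x (N : nat) (V : R -> R -> C) (x tau : R) : C :=
  interp N (fun y => V y tau) x.

(** [F(., tau)] is the element of [S_N] whose nodal values are those of
    [v_tau - A v_xx - B v_x - Cc (v_x)^2], for a given [v = v(x, tau)]. *)
Definition nodal_residual (A B Cc T : R) (N : nat) (v F : R -> R -> C) : Prop :=
  forall tau, 0 <= tau <= T ->
    in_S N (fun x => F x tau) /\
    forall j, (j < 2 * N)%nat ->
      let vx := CDerive (fun x => v x tau) in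
      let xj := node N j in
      exists vtau : C,
        is_derive_on 0 T (fun s => v xj s) tau vtau /\
        F xj tau =
          (vtau - RtoC A * CDerive vx xj - RtoC B * vx xj
           - RtoC Cc * (vx xj * vx xj))%C.

Definition is_max_on (f : R -> R) (a b m : R) : Prop :=
  (exists t, a <= t <= b /\ f t = m) /\ forall t, a <= t <= b -> f t <= m.

(* Main.v *)
Require Import Defs.
From Stdlib Require Import Reals ZArith Lra Lia FunctionalExtensionality.
From Coquelicot Require Import Coquelicot.
Open Scope R_scope.

(** The error [e = V^N - W^N] lies in [S_N], and at the nodes it satisfies
    [J = e_t - A e_xx - B e_x - C (V^N_x + W^N_x) e_x].  On [S_N] the nodal
    quadrature coincides with the [L^2] inner product (discrete Parseval), so
    pairing this relation with [e] at the nodes gives the usual energy estimate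
    without aliasing: the [B] term has zero real part, and the nonlinear term,
    which need not lie in [S_N], is bounded pointwise at the nodes by
    [2 M |e_x| |e|] and absorbed into [A ||e_x||^2] by Young's inequality.
    Gronwall concludes with [R = 2 exp ((4 M^2 A + 1) T)]. *)

(** * Inner products on coefficients and on nodal values *)

(** This is [Re (u * conj v)]: the energy estimate needs only real parts, so all pairings are
    real-valued from the start. *)
Definition cdot (u v : C) : R := fst u * fst v + snd u * snd v.

Definition trig (N : nat) (c : Z -> C) (x : R) : C :=
  sum_n (fun m => (c (freq N m) * expi (freq N m) x)%C) (2 * N - 1).

Definition coef_dot (N : nat) (c d : Z -> C) : R :=
  2 * PI * sum_n (fun m => cdot (c (freq N m)) (d (freq N m))) (2 * N - 1).

(** The trapezoidal rule on one period: the weight [PI / N] is the node spacing [2 PI / (2 N)]. *)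
Definition node_dot (N : nat) (u v : R -> C) : R :=
  PI / INR N * sum_n (fun j => cdot (u (node N j)) (v (node N j))) (2 * N - 1).

(** Coefficients of the derivative of [trig N c]. *)
Definition dcoef (c : Z -> C) (k : Z) : C := (Ci * RtoC (IZR k) * c k)%C.

(** * Finite real and complex sums *)

Lemma rsum_plus (f g : nat -> R) (n : nat) :
  sum_n (fun m => f m + g m) n = sum_n f n + sum_n g n.
Proof. exact (sum_n_plus f g n). Qed.

Lemma rsum_scal (a : R) (f : nat -> R) (n : nat) :
  sum_n (fun m => a * f m) n = a * sum_n f n.
Proof. exact (sum_n_mult_l a f n). Qed.

Lemma rsum_le (f g : nat -> R) (n : nat) :
  (forall m, (m <= n)%nat -> f m <= g m) -> sum_n f n <= sum_n g n.
Proof.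
  induction n as [|n IH]; intros H.
  - rewrite !sum_O. now apply H.
  - rewrite !sum_Sn. apply Rplus_le_compat; [apply IH; intros; apply H; lia|].
    now apply H.
Qed.

Lemma rsum_ge_0 (f : nat -> R) (n : nat) :
  (forall m, (m <= n)%nat -> 0 <= f m) -> 0 <= sum_n f n.
Proof.
  intros H. apply Rle_trans with (sum_n (fun _ => 0) n).
  - rewrite sum_n_const, Rmult_0_r. apply Rle_refl.
  - now apply rsum_le.
Qed.

Lemma sum_n_single (a : nat -> R) (n m : nat) :
  (m <= n)%nat -> (forall k, (k <= n)%nat -> k <> m -> a k = 0) ->
  sum_n a n = a m.
Proof.
  induction n as [|n IH]; intros Hm H.
  - rewrite sum_O. now replace m with 0%nat by lia.
  - rewrite sum_Sn. change (sum_n a n + a (S n) = a m).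
    destruct (Nat.eq_dec m (S n)) as [->|Hne].
    (* Zero is written [0 * 0] so that [rsum_scal] can pull the factor [0] out of the sum. *)
    + rewrite (sum_n_ext_loc a (fun _ => 0 * 0) n).
      * rewrite rsum_scal. ring.
      * intros k Hk. rewrite H by lia. symmetry; apply Rmult_0_l.
    + rewrite IH by (try intros; try apply H; lia).
      rewrite (H (S n)) by lia. ring.
Qed.

Lemma csum_fst (f : nat -> C) (n : nat) :
  fst (sum_n f n) = sum_n (fun m => fst (f m)) n.
Proof.
  induction n as [|n IH].
  - now rewrite !sum_O.
  - rewrite !sum_Sn, <- IH. reflexivity.
Qed.

Lemma csum_snd (f : nat -> C) (n : nat) :
  snd (sum_n f n) = sum_n (fun m => snd (f m)) n.
Proof.
  induction n as [|n IH].
  - now rewrite !sum_O.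
  - rewrite !sum_Sn, <- IH. reflexivity.
Qed.

Lemma cdot_sum_l (f : nat -> C) (v : C) (n : nat) :
  cdot (sum_n f n) v = sum_n (fun m => cdot (f m) v) n.
Proof.
  unfold cdot. rewrite csum_fst, csum_snd, rsum_plus.
  rewrite !(Rmult_comm (sum_n _ _)), <- !rsum_scal.
  f_equal; apply sum_n_ext; intros; apply Rmult_comm.
Qed.

Lemma cdot_comm (u v : C) : cdot u v = cdot v u.
Proof. unfold cdot; ring. Qed.

Lemma cdot_sum_r (f : nat -> C) (v : C) (n : nat) :
  cdot v (sum_n f n) = sum_n (fun m => cdot v (f m)) n.
Proof.
  rewrite cdot_comm, cdot_sum_l. apply sum_n_ext; intros; apply cdot_comm.
Qed.

Lemma cdot_Cmod (u : C) : Cmod u ^ 2 = cdot u u.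
Proof.
  unfold Cmod, cdot. rewrite pow2_sqrt; [ring|].
  apply Rplus_le_le_0_compat; apply pow2_ge_0.
Qed.

Lemma cdot_ge_0 (u : C) : 0 <= cdot u u.
Proof. rewrite <- cdot_Cmod. apply pow2_ge_0. Qed.

(** This is the real part of [c * conj d * e^{i(k-l)x}]. Only the difference of the frequencies
    enters, which reduces orthogonality to single cosines and sines. *)
Lemma cdot_expi (c d : C) (k l : Z) (x : R) :
  cdot (c * expi k x)%C (d * expi l x)%C =
  cdot c d * cos (IZR (k - l) * x)
  + (fst c * snd d - snd c * fst d) * sin (IZR (k - l) * x).
Proof.
  destruct c as [c1 c2], d as [d1 d2].
  rewrite minus_IZR, Rmult_minus_distr_r, cos_minus, sin_minus.
  unfold cdot, expi; simpl. ring.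
Qed.

(** Orthogonality is stated for an abstract linear functional [I] so that the
    integral and the nodal quadrature are treated at once: both send the
    characters of order below [2N] to the same values. *)
Lemma parseval_gen (N : nat) (I : (R -> R) -> R -> Prop)
  (Iplus : forall f g a b, I f a -> I g b -> I (fun x => f x + g x) (a + b))
  (Iscal : forall f a r, I f a -> I (fun x => r * f x) (r * a))
  (Icos : forall n, (Z.abs n < 2 * Z.of_nat N)%Z ->
     I (fun x => cos (IZR n * x)) (if Z.eq_dec n 0 then 2 * PI else 0))
  (Isin : forall n, (Z.abs n < 2 * Z.of_nat N)%Z ->
     I (fun x => sin (IZR n * x)) 0)
  (c d : Z -> C) :
  (1 <= N)%nat ->
  I (fun x => cdot (trig N c x) (trig N d x)) (coef_dot N c d).
Proof.
  intros HN.
  assert (Isum : forall (f : nat -> R -> R) (a : nat -> R) n,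
    (forall m, (m <= n)%nat -> I (f m) (a m)) ->
    I (fun x => sum_n (fun m => f m x) n) (sum_n a n)).
  { intros f a n; induction n as [|n IH]; intros H.
    - rewrite sum_O.
      replace (fun x => _) with (f 0%nat); [now apply H|].
      apply functional_extensionality; intros x; now rewrite sum_O.
    - rewrite sum_Sn.
      replace (fun x => _) with (fun x => sum_n (fun m => f m x) n + f (S n) x).
      + apply Iplus; [apply IH; intros; apply H; lia|now apply H].
      + apply functional_extensionality; intros x; now rewrite sum_Sn. }
  set (n := (2 * N - 1)%nat).
  set (val := fun m l =>
    cdot (c (freq N m)) (d (freq N l))
      * (if Z.eq_dec (freq N m - freq N l) 0 then 2 * PI else 0)
    + (fst (c (freq N m)) * snd (d (freq N l))
       - snd (c (freq N m)) * fst (d (freq N l))) * 0).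
  replace (coef_dot N c d) with (sum_n (fun m => sum_n (fun l => val m l) n) n).
  2:{ unfold coef_dot. rewrite <- rsum_scal. apply sum_n_ext_loc; intros m Hm.
      rewrite (sum_n_single _ n m Hm); unfold val.
      - rewrite Z.sub_diag; simpl. ring.
      - intros k _ Hk. unfold freq. destruct Z.eq_dec; [lia|ring]. }
  replace (fun x => _) with (fun x => sum_n (fun m => sum_n (fun l =>
    cdot (c (freq N m)) (d (freq N l)) * cos (IZR (freq N m - freq N l) * x)
    + (fst (c (freq N m)) * snd (d (freq N l))
       - snd (c (freq N m)) * fst (d (freq N l)))
      * sin (IZR (freq N m - freq N l) * x)) n) n).
  2:{ apply functional_extensionality; intros x. unfold trig.
      rewrite cdot_sum_l. apply sum_n_ext; intros m.
      rewrite cdot_sum_r. apply sum_n_ext; intros l.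
      now rewrite cdot_expi. }
  apply Isum; intros m Hm. apply Isum; intros l Hl.
  (* Two of the [2N] consecutive frequencies differ by at most [2N - 1]; this is why products of two
     elements of [S_N] suffer no aliasing. *)
  assert (Z.abs (freq N m - freq N l) < 2 * Z.of_nat N)%Z
    by (unfold freq, n in *; lia).
  apply Iplus; apply Iscal; auto.
Qed.

Lemma sin_IZR_PI (n : Z) : sin (IZR n * PI) = 0.
Proof. apply sin_eq_0_1. now exists n. Qed.

Lemma cos_IZR_2PI (n : Z) : cos (IZR n * (2 * PI)) = 1.
Proof.
  replace (IZR n * (2 * PI)) with (2 * (IZR n * PI)) by ring.
  rewrite cos_2a_sin, sin_IZR_PI. ring.
Qed.

Lemma sin_IZR_2PI (n : Z) : sin (IZR n * (2 * PI)) = 0.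
Proof.
  replace (IZR n * (2 * PI)) with (IZR (n * 2) * PI)
    by (rewrite mult_IZR; ring).
  apply sin_IZR_PI.
Qed.

Lemma RInt_cos_IZR (n : Z) :
  is_RInt (fun x => cos (IZR n * x)) 0 (2 * PI)
    (if Z.eq_dec n 0 then 2 * PI else 0).
Proof.
  destruct Z.eq_dec as [->|Hn].
  - apply (is_RInt_ext (fun _ => 1)).
    + intros; now rewrite Rmult_0_l, cos_0.
    + evar_last; [exact (is_RInt_const 0 (2 * PI) 1)|].
      unfold scal; simpl; unfold mult; simpl; ring.
  - apply not_0_IZR in Hn.
    evar_last.
    + apply (is_RInt_derive (fun x => sin (IZR n * x) / IZR n)).
      * intros; auto_derive; auto. now field.
      * intros. apply (ex_derive_continuous (V := R_NormedModule)).
        auto_derive; auto.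
    + unfold minus, plus, opp; simpl.
      rewrite sin_IZR_2PI, Rmult_0_r, sin_0. field; auto.
Qed.

Lemma RInt_sin_IZR (n : Z) :
  is_RInt (fun x => sin (IZR n * x)) 0 (2 * PI) 0.
Proof.
  destruct (Z.eq_dec n 0) as [->|Hn].
  - apply (is_RInt_ext (fun _ => 0)).
    + intros; now rewrite Rmult_0_l, sin_0.
    + evar_last; [exact (is_RInt_const 0 (2 * PI) 0)|].
      unfold scal; simpl; unfold mult; simpl; ring.
  - apply not_0_IZR in Hn.
    evar_last.
    + apply (is_RInt_derive (fun x => - cos (IZR n * x) / IZR n)).
      * intros; auto_derive; auto. now field.
      * intros. apply (ex_derive_continuous (V := R_NormedModule)).
        auto_derive; auto.
    + unfold minus, plus, opp; simpl.
      rewrite cos_IZR_2PI, Rmult_0_r, cos_0. field; auto.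
Qed.

Lemma parseval_integral (N : nat) (c d : Z -> C) :
  (1 <= N)%nat ->
  is_RInt (fun x => cdot (trig N c x) (trig N d x)) 0 (2 * PI) (coef_dot N c d).
Proof.
  apply (parseval_gen N (fun f l => is_RInt f 0 (2 * PI) l)).
  - intros f g a b. apply (is_RInt_plus (V := R_NormedModule)).
  - intros f a r. apply (is_RInt_scal (V := R_NormedModule)).
  - intros n _. apply RInt_cos_IZR.
  - intros n _. apply RInt_sin_IZR.
Qed.

(** Telescoping, after multiplication by [2 sin (t / 2)]. *)
Lemma sum_cos_telescope (t : R) (n : nat) :
  2 * sin (t / 2) * sum_n (fun j => cos (INR j * t)) n =
  sin (INR n * t + t / 2) + sin (t / 2).
Proof.
  induction n as [|n IH].
  - rewrite sum_O; simpl. rewrite Rmult_0_l, Rplus_0_l, cos_0. ring.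
  - rewrite sum_Sn. unfold plus; simpl plus.
    change (2 * sin (t / 2) * (sum_n (fun j => cos (INR j * t)) n
      + cos (INR (S n) * t)) = sin (INR (S n) * t + t / 2) + sin (t / 2)).
    rewrite Rmult_plus_distr_l, IH.
    replace (INR n * t + t / 2) with (INR (S n) * t - t / 2)
      by (rewrite S_INR; field).
    rewrite sin_plus, sin_minus. ring.
Qed.

Lemma sum_sin_telescope (t : R) (n : nat) :
  2 * sin (t / 2) * sum_n (fun j => sin (INR j * t)) n =
  cos (t / 2) - cos (INR n * t + t / 2).
Proof.
  induction n as [|n IH].
  - rewrite sum_O; simpl. rewrite Rmult_0_l, Rplus_0_l, sin_0. ring.
  - rewrite sum_Sn.
    change (2 * sin (t / 2) * (sum_n (fun j => sin (INR j * t)) n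
      + sin (INR (S n) * t)) = cos (t / 2) - cos (INR (S n) * t + t / 2)).
    rewrite Rmult_plus_distr_l, IH.
    replace (INR n * t + t / 2) with (INR (S n) * t - t / 2)
      by (rewrite S_INR; field).
    rewrite cos_plus, cos_minus. ring.
Qed.

(** A zero would make [n PI / (2N)] an integer multiple of [PI], so [2N] would divide [n],
    impossible for [0 < |n| < 2N]. This allows cancelling the factor [2 sin (t / 2)] in the
    telescoped sums. *)
Lemma sin_half_angle_neq_0 (N : nat) (n : Z) :
  (1 <= N)%nat -> n <> 0%Z -> (Z.abs n < 2 * Z.of_nat N)%Z ->
  sin (IZR n * (PI / INR N) / 2) <> 0.
Proof.
  intros HN Hn Hlt Hs.
  apply le_INR in HN; simpl in HN.
  apply sin_eq_0_0 in Hs as [k Hk].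
  assert (IZR n = IZR (2 * Z.of_nat N * k)) as E%eq_IZR.
  { rewrite !mult_IZR, <- INR_IZR_INZ. generalize PI_RGT_0; intros.
    apply (Rmult_eq_reg_r (PI / INR N / 2)).
    2:{ apply Rgt_not_eq. repeat apply Rdiv_lt_0_compat; lra. }
    transitivity (IZR n * (PI / INR N) / 2); [field; lra|].
    rewrite Hk. field; lra. }
  destruct (Z.eq_dec k 0); [lia|].
  nia.
Qed.

Lemma node_angle (N j : nat) (n : Z) :
  (1 <= N)%nat ->
  IZR n * node N j = INR j * (IZR n * (PI / INR N)).
Proof.
  intros HN%le_INR; simpl in HN. unfold node. field; lra.
Qed.

(** The final angle of the telescoped sum is [- t / 2] modulo [2 PI], so the two boundary terms
    cancel for the cosine sum and for the sine sum alike. *)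
Lemma last_angle (N : nat) (n : Z) :
  (1 <= N)%nat ->
  INR (2 * N - 1) * (IZR n * (PI / INR N)) + IZR n * (PI / INR N) / 2
  = IZR n * (2 * PI) - IZR n * (PI / INR N) / 2.
Proof.
  intros HN. rewrite minus_INR, mult_INR by lia.
  apply le_INR in HN; simpl in HN |- *. field; lra.
Qed.

Lemma node_sum_cos (N : nat) (n : Z) :
  (1 <= N)%nat -> (Z.abs n < 2 * Z.of_nat N)%Z ->
  PI / INR N * sum_n (fun j => cos (IZR n * node N j)) (2 * N - 1)
  = if Z.eq_dec n 0 then 2 * PI else 0.
Proof.
  intros HN Hn. destruct Z.eq_dec as [->|H0].
  - rewrite (sum_n_ext _ (fun _ => 1)) by (intros; now rewrite Rmult_0_l, cos_0).
    rewrite sum_n_const. replace (S (2 * N - 1)) with (2 * N)%nat by lia.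
    rewrite mult_INR. apply le_INR in HN; simpl in HN |- *. field; lra.
  - rewrite (sum_n_ext _ (fun j => cos (INR j * (IZR n * (PI / INR N)))))
      by (intros; now rewrite node_angle).
    apply (Rmult_eq_reg_l (2 * sin (IZR n * (PI / INR N) / 2))).
    2:{ generalize (sin_half_angle_neq_0 N n HN H0 Hn); lra. }
    rewrite (Rmult_comm (PI / INR N)), <- Rmult_assoc, sum_cos_telescope.
    rewrite last_angle, sin_minus, sin_IZR_2PI, cos_IZR_2PI by easy. ring.
Qed.

Lemma node_sum_sin (N : nat) (n : Z) :
  (1 <= N)%nat -> (Z.abs n < 2 * Z.of_nat N)%Z ->
  PI / INR N * sum_n (fun j => sin (IZR n * node N j)) (2 * N - 1) = 0.
Proof.
  intros HN Hn. destruct (Z.eq_dec n 0) as [->|H0].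
  - rewrite (sum_n_ext _ (fun _ => 0)) by (intros; now rewrite Rmult_0_l, sin_0).
    rewrite sum_n_const. ring.
  - rewrite (sum_n_ext _ (fun j => sin (INR j * (IZR n * (PI / INR N)))))
      by (intros; now rewrite node_angle).
    apply (Rmult_eq_reg_l (2 * sin (IZR n * (PI / INR N) / 2))).
    2:{ generalize (sin_half_angle_neq_0 N n HN H0 Hn); lra. }
    rewrite (Rmult_comm (PI / INR N)), <- Rmult_assoc, sum_sin_telescope.
    rewrite last_angle, cos_minus, sin_IZR_2PI, cos_IZR_2PI by easy. ring.
Qed.

Lemma parseval_nodes (N : nat) (c d : Z -> C) :
  (1 <= N)%nat -> node_dot N (trig N c) (trig N d) = coef_dot N c d.
Proof.
  intros HN.
  apply (parseval_gen N (fun f l =>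
    PI / INR N * sum_n (fun j => f (node N j)) (2 * N - 1) = l)); trivial.
  - intros f g a b <- <-. rewrite rsum_plus. ring.
  - intros f a r <-. rewrite rsum_scal. ring.
  - intros n. now apply node_sum_cos.
  - intros n. now apply node_sum_sin.
Qed.

Lemma L2norm_trig (N : nat) (c : Z -> C) :
  (1 <= N)%nat -> L2norm (trig N c) ^ 2 = coef_dot N c c.
Proof.
  intros HN. unfold L2norm.
  rewrite (RInt_ext _ (fun x => cdot (trig N c x) (trig N c x)))
    by (intros; apply cdot_Cmod).
  rewrite (is_RInt_unique _ _ _ _ (parseval_integral N c c HN)).
  apply pow2_sqrt. unfold coef_dot. generalize PI_RGT_0; intros.
  apply Rmult_le_pos; [lra|].
  apply rsum_ge_0; intros; apply cdot_ge_0.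
Qed.

Lemma coef_dot_ge_0 (N : nat) (c : Z -> C) : (1 <= N)%nat -> 0 <= coef_dot N c c.
Proof. intros HN. rewrite <- L2norm_trig by easy. apply pow2_ge_0. Qed.

(** * Differentiation in [x] on the coefficient side *)

Lemma CDerive_trig (N : nat) (c : Z -> C) :
  CDerive (trig N c) = trig N (dcoef c).
Proof.
  apply functional_extensionality; intros x.
  unfold CDerive, trig.
  apply injective_projections; [rewrite csum_fst|rewrite csum_snd];
    apply is_derive_unique.
  - apply (is_derive_ext (fun y => sum_n (fun m =>
      fst (c (freq N m) * expi (freq N m) y)%C) (2 * N - 1))).
    { intros; now rewrite csum_fst. }
    apply (is_derive_sum_n (V := R_NormedModule)
      (fun m y => fst (c (freq N m) * expi (freq N m) y)%C)).
    intros m _. unfold dcoef; destruct (c (freq N m)) as [a b]; simpl.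
    auto_derive; auto. ring.
  - apply (is_derive_ext (fun y => sum_n (fun m =>
      snd (c (freq N m) * expi (freq N m) y)%C) (2 * N - 1))).
    { intros; now rewrite csum_snd. }
    apply (is_derive_sum_n (V := R_NormedModule)
      (fun m y => snd (c (freq N m) * expi (freq N m) y)%C)).
    intros m _. unfold dcoef; destruct (c (freq N m)) as [a b]; simpl.
    auto_derive; auto. ring.
Qed.

Lemma trig_minus (N : nat) (c d : Z -> C) (x : R) :
  trig N (fun k => (c k - d k)%C) x = (trig N c x - trig N d x)%C.
Proof.
  unfold trig. generalize (2 * N - 1)%nat; intros n.
  induction n as [|n IH].
  - rewrite !sum_O. ring.
  - rewrite !sum_Sn, IH. unfold plus; simpl. ring.
Qed.

Lemma dcoef_minus (c d : Z -> C) :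
  dcoef (fun k => (c k - d k)%C) = fun k => (dcoef c k - dcoef d k)%C.
Proof. apply functional_extensionality; intros k; unfold dcoef; ring. Qed.

(** Multiplication by [i k] rotates each coefficient by a right angle, up to a real factor. This
    removes the [B] term. *)
Lemma coef_dot_dcoef (N : nat) (c : Z -> C) : coef_dot N c (dcoef c) = 0.
Proof.
  unfold coef_dot. rewrite (sum_n_ext _ (fun _ => 0 * 0)).
  - rewrite rsum_scal. ring.
  - intros m. unfold cdot, dcoef; simpl. ring.
Qed.

(** Integration by parts in Fourier form, from [(i k)^2 = - k^2]; it produces the dissipation of the
    [A] term. *)
Lemma coef_dot_dcoef2 (N : nat) (c : Z -> C) :
  coef_dot N c (dcoef (dcoef c)) = - coef_dot N (dcoef c) (dcoef c).
Proof.
  unfold coef_dot.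
  replace (- _) with (2 * PI * (- 1 * sum_n (fun m =>
    cdot (dcoef c (freq N m)) (dcoef c (freq N m))) (2 * N - 1))) by ring.
  f_equal. rewrite <- rsum_scal. apply sum_n_ext; intros m.
  unfold cdot, dcoef; simpl. ring.
Qed.

(** * The energy inequality at a fixed time *)

Lemma node_range (N j : nat) :
  (1 <= N)%nat -> (j <= 2 * N - 1)%nat -> 0 <= node N j <= 2 * PI.
Proof.
  intros HN Hj. unfold node.
  assert (INR j <= 2 * INR N).
  { change 2 with (INR 2). rewrite <- mult_INR. apply le_INR; lia. }
  apply le_INR in HN; simpl in HN.
  generalize PI_RGT_0 (pos_INR j); intros. split.
  - apply Rmult_le_pos; [nra|]. left; apply Rinv_0_lt_compat; lra.
  - apply (Rmult_le_reg_r (INR N)); [lra|].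
    unfold Rdiv; rewrite Rmult_assoc, Rinv_l by lra. nra.
Qed.

(** Expand [|conj(s) u - y|^2 >= 0]: its cross term is [-2 Re (u conj (s y))], and
    [|s|^2 <= 4 M^2]. *)
Lemma cdot_young (A M : R) (s u y : C) :
  0 <= A -> 0 <= M -> Cmod s <= 2 * M ->
  2 * A * cdot u (s * y)%C <= A * cdot y y + 4 * M ^ 2 * A * cdot u u.
Proof.
  intros HA HM Hs.
  assert (Hs2 : cdot s s <= 4 * M ^ 2).
  { rewrite <- cdot_Cmod. generalize (Cmod_ge_0 s). nra. }
  assert (Hu := cdot_ge_0 u).
  assert (H : 2 * cdot u (s * y)%C <= cdot y y + cdot s s * cdot u u).
  { generalize (cdot_ge_0 (Cconj s * u - y)%C).
    unfold cdot; simpl. lra. }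
  assert (cdot s s * cdot u u <= 4 * M ^ 2 * cdot u u)
    by now apply Rmult_le_compat_r.
  nra.
Qed.

(** Only the nodal values of [c'] and [d] are related; the differential
    identity is tested against [trig N c] in the nodal inner product and every
    pairing within [S_N] is moved to coefficients by [parseval_nodes]. *)
Lemma energy_inequality (N : nat) (A B M : R) (c c' d : Z -> C) (s : nat -> C) :
  (1 <= N)%nat -> 0 <= A -> 0 <= M ->
  (forall j, (j <= 2 * N - 1)%nat -> Cmod (s j) <= 2 * M) ->
  (forall j, (j <= 2 * N - 1)%nat ->
     trig N d (node N j) =
     (trig N c' (node N j) - RtoC A * trig N (dcoef (dcoef c)) (node N j)
      - RtoC B * trig N (dcoef c) (node N j)
      - RtoC A * (s j * trig N (dcoef c) (node N j)))%C) ->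
  2 * coef_dot N c c' + A * coef_dot N (dcoef c) (dcoef c)
  <= (4 * M ^ 2 * A + 1) * coef_dot N c c + coef_dot N d d.
Proof.
  intros HN HA HM Hs Hd.
  set (u := trig N c). set (y := trig N (dcoef c)).
  assert (H : 2 * node_dot N u (trig N c') <=
    (4 * M ^ 2 * A + 1) * node_dot N u u + node_dot N (trig N d) (trig N d)
    + 2 * A * node_dot N u (trig N (dcoef (dcoef c)))
    + 2 * B * node_dot N u y + A * node_dot N y y).
  { unfold node_dot.
    assert (0 < PI / INR N).
    { apply Rdiv_lt_0_compat; [apply PI_RGT_0|]. apply lt_0_INR; lia. }
    (* The positive weight [PI / N] is common to all terms, so it suffices to compare the bare sums,
       which is then done node by node. *)
    match goal with |- 2 * (_ * ?a) <=
      _ * (_ * ?b) + _ * ?c + _ * (_ * ?e) + _ * (_ * ?f) + _ * (_ * ?g) =>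
      enough (2 * a <= (4 * M ^ 2 * A + 1) * b + c + 2 * A * e + 2 * B * f + A * g)
    end.
    { match goal with H : ?k * _ <= _ |- _ =>
        apply (Rmult_le_compat_l (PI / INR N)) in H; [|lra] end. lra. }
    rewrite <- !rsum_scal, <- !rsum_plus. apply rsum_le; intros j Hj.
    specialize (Hd j Hj).
    (* Young's inequality handles the nonlinear term; [|u - d|^2 >= 0] handles the pairing with the
       residual and accounts for the [+ 1] in the constant. *)
    generalize (cdot_young A M (s j) (u (node N j)) (y (node N j)) HA HM (Hs j Hj)).
    generalize (cdot_ge_0 (u (node N j) - trig N d (node N j))%C).
    fold y in Hd. revert Hd.
    generalize (trig N d (node N j)) (trig N c' (node N j)) (u (node N j))
      (y (node N j)) (trig N (dcoef (dcoef c)) (node N j)).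
    intros [d1 d2] [t1 t2] [u1 u2] [y1 y2] [z1 z2].
    destruct (s j) as [s1 s2]. unfold cdot; simpl. intros [= -> ->]. lra. }
  (* On coefficients the second-derivative term becomes [- 2 A ||e_x||^2]: half of it absorbs the
     [A ||e_x||^2] from Young's inequality, and the other half moves to the left-hand side. *)
  unfold u, y in H.
  rewrite !parseval_nodes, coef_dot_dcoef, coef_dot_dcoef2 in H by easy.
  lra.
Qed.

(** * Gronwall's inequality with a dissipation term *)

Lemma is_derive_RInt_of_continuous (f : R -> R) (t : R) :
  (forall s, continuous f s) -> is_derive (fun s => RInt f 0 s) t (f t).
Proof.
  intros Hf. apply (is_derive_RInt (V := R_NormedModule) f _ 0); [|apply Hf].
  apply filter_forall; intros b.
  apply (RInt_correct (V := R_CompleteNormedModule)).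
  apply (ex_RInt_continuous (V := R_CompleteNormedModule)). auto.
Qed.

(** The quantity [exp (- K t) (E t + A int_0^t D) - int_0^t j] is
    nonincreasing. *)
Lemma gronwall (E E' D j : R -> R) (A K T : R) :
  0 <= A -> 0 <= K ->
  (forall t, continuous E t) -> (forall t, continuous D t) ->
  (forall t, continuous j t) ->
  (forall t, 0 <= D t) -> (forall t, 0 <= j t) ->
  (forall t, 0 < t < T -> is_derive E t (E' t)) ->
  (forall t, 0 < t < T -> E' t + A * D t <= K * E t + j t) ->
  forall t, 0 <= t <= T ->
  E t + A * RInt D 0 t <= exp (K * t) * (E 0 + RInt j 0 t).
Proof.
  intros HA HK CE CD Cj PD Pj dE Hineq t Ht.
  set (ID := fun s => RInt D 0 s). set (IJ := fun s => RInt j 0 s).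
  change (E t + A * ID t <= exp (K * t) * (E 0 + IJ t)).
  assert (dID : forall s, is_derive ID s (D s))
    by (intros; now apply is_derive_RInt_of_continuous).
  assert (dIJ : forall s, is_derive IJ s (j s))
    by (intros; now apply is_derive_RInt_of_continuous).
  assert (ID0 : ID 0 = 0) by exact (RInt_point (V := R_CompleteNormedModule) 0 D).
  assert (IJ0 : IJ 0 = 0) by exact (RInt_point (V := R_CompleteNormedModule) 0 j).
  assert (ID_ge_0 : forall s, 0 <= s -> 0 <= ID s).
  { intros s Hs. apply RInt_ge_0; auto.
    apply (ex_RInt_continuous (V := R_CompleteNormedModule)). auto. }
  set (g := fun s => exp (- (K * s)) * (E s + A * ID s) - IJ s).
  set (dg := fun s =>
    exp (- (K * s)) * (E' s + A * D s - K * (E s + A * ID s)) - j s).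
  (* [Rmin _ 0] only matters at the endpoints, where [MVT_gen] may return a
     point at which [E] has no derivative. *)
  destruct (MVT_gen g 0 t (fun s => Rmin (dg s) 0)) as [c [_ Hc]].
  - rewrite Rmin_left, Rmax_right by lra. intros s Hs.
    assert (Hs' : 0 < s < T) by lra.
    specialize (dE s Hs'); specialize (Hineq s Hs').
    rewrite Rmin_left.
    + unfold g. auto_derive.
      * repeat split; [now exists (E' s)|now exists (D s)|now exists (j s)].
      * replace (Derive (fun x : R => E x) s) with (E' s)
          by (symmetry; now apply is_derive_unique).
        replace (Derive (fun x : R => ID x) s) with (D s)
          by (symmetry; now apply is_derive_unique).
        replace (Derive (fun x : R => IJ x) s) with (j s)
          by (symmetry; now apply is_derive_unique).
        unfold dg. ring.
    (* By the differential inequality the bracket is at most [j s - K * A * ID s], hence at most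
       [j s]; then [exp (- K s) <= 1] and [j s >= 0] give [dg s <= 0]. *)
    + unfold dg.
      assert (exp (- (K * s)) <= 1).
      { rewrite <- exp_0. assert (0 <= K * s) by nra.
        destruct (Req_dec (K * s) 0) as [->|]; [rewrite Ropp_0; lra|].
        left; apply exp_increasing; lra. }
      generalize (exp_pos (- (K * s))) (Pj s); intros.
      assert (0 <= K * (A * ID s)).
      { apply Rmult_le_pos; [lra|].
        apply Rmult_le_pos; [lra|apply ID_ge_0; lra]. }
      assert (exp (- (K * s)) * (E' s + A * D s - K * (E s + A * ID s))
              <= exp (- (K * s)) * j s) by (apply Rmult_le_compat_l; lra).
      nra.
  - intros s _. apply continuity_pt_filterlim.
    apply (continuous_minus (V := R_NormedModule)).
    + apply (continuous_mult (K := R_AbsRing)).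
      * apply (ex_derive_continuous (V := R_NormedModule)). auto_derive; auto.
      * apply (continuous_plus (V := R_NormedModule)); [apply CE|].
        apply (continuous_scal_r (V := R_NormedModule) A).
        apply (ex_derive_continuous (V := R_NormedModule)). now exists (D s).
    + apply (ex_derive_continuous (V := R_NormedModule)). now exists (j s).
  - assert (Hg : g t <= E 0).
    { assert (g 0 = E 0).
      { unfold g. rewrite ID0, IJ0, Rmult_0_r, Ropp_0, exp_0. ring. }
      generalize (Rmin_r (dg c) 0); nra. }
    apply (Rmult_le_reg_l (exp (- (K * t)))); [apply exp_pos|].
    rewrite <- Rmult_assoc, <- exp_plus, Rplus_opp_l, exp_0, Rmult_1_l.
    unfold g in Hg. lra.
Qed.

(** * Continuity and differentiability in time of complex-valued functions *)

(** Continuity and derivatives are taken componentwise, matching [cdot], so that real calculus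
    applies to each component. *)
Definition ccont (f : R -> C) : Prop :=
  forall t, continuous (fun s => fst (f s)) t /\ continuous (fun s => snd (f s)) t.

Definition is_cderive (f : R -> C) (t : R) (l : C) : Prop :=
  is_derive (fun s => fst (f s)) t (fst l) /\
  is_derive (fun s => snd (f s)) t (snd l).

Lemma rcont_sum (f : nat -> R -> R) (n : nat) (t : R) :
  (forall m, (m <= n)%nat -> continuous (f m) t) ->
  continuous (fun s => sum_n (fun m => f m s) n) t.
Proof.
  induction n as [|n IH]; intros H.
  - apply (continuous_ext (f 0%nat)); [|now apply H].
    intros; now rewrite sum_O.
  - apply (continuous_ext (fun s => plus (sum_n (fun m => f m s) n) (f (S n) s))).
    { intros; now rewrite sum_Sn. }
    apply (continuous_plus (V := R_NormedModule)); [|now apply H].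
    apply IH; intros; apply H; lia.
Qed.

Lemma ccont_const (a : C) : ccont (fun _ => a).
Proof. split; apply continuous_const. Qed.

Lemma ccont_minus (f g : R -> C) :
  ccont f -> ccont g -> ccont (fun s => (f s - g s)%C).
Proof.
  intros Hf Hg t. destruct (Hf t) as [Hf1 Hf2], (Hg t) as [Hg1 Hg2]. split.
  - exact (continuous_minus (V := R_NormedModule) _ _ _ Hf1 Hg1).
  - exact (continuous_minus (V := R_NormedModule) _ _ _ Hf2 Hg2).
Qed.

Lemma ccont_mult (f g : R -> C) :
  ccont f -> ccont g -> ccont (fun s => (f s * g s)%C).
Proof.
  intros Hf Hg t. destruct (Hf t) as [Hf1 Hf2], (Hg t) as [Hg1 Hg2]. split.
  - exact (continuous_minus (V := R_NormedModule) _ _ _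
      (continuous_mult (K := R_AbsRing) _ _ _ Hf1 Hg1)
      (continuous_mult (K := R_AbsRing) _ _ _ Hf2 Hg2)).
  - exact (continuous_plus (V := R_NormedModule) _ _ _
      (continuous_mult (K := R_AbsRing) _ _ _ Hf1 Hg2)
      (continuous_mult (K := R_AbsRing) _ _ _ Hf2 Hg1)).
Qed.

Lemma ccont_sum (f : nat -> R -> C) (n : nat) :
  (forall m, (m <= n)%nat -> ccont (f m)) ->
  ccont (fun s => sum_n (fun m => f m s) n).
Proof.
  intros H t; split.
  - apply (continuous_ext (fun s => sum_n (fun m => fst (f m s)) n)).
    { intros; now rewrite csum_fst. }
    apply rcont_sum; intros; now apply H.
  - apply (continuous_ext (fun s => sum_n (fun m => snd (f m s)) n)).
    { intros; now rewrite csum_snd. }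
    apply rcont_sum; intros; now apply H.
Qed.

Lemma continuous_cdot (f g : R -> C) (t : R) :
  ccont f -> ccont g -> continuous (fun s => cdot (f s) (g s)) t.
Proof.
  intros Hf Hg. destruct (Hf t) as [Hf1 Hf2], (Hg t) as [Hg1 Hg2].
  exact (continuous_plus (V := R_NormedModule) _ _ _
    (continuous_mult (K := R_AbsRing) _ _ _ Hf1 Hg1)
    (continuous_mult (K := R_AbsRing) _ _ _ Hf2 Hg2)).
Qed.

Lemma continuous_coef_dot (N : nat) (c d : R -> Z -> C) (t : R) :
  (forall k, ccont (fun s => c s k)) -> (forall k, ccont (fun s => d s k)) ->
  continuous (fun s => coef_dot N (c s) (d s)) t.
Proof.
  intros Hc Hd.
  apply (continuous_scal_r (V := R_NormedModule) (2 * PI)).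
  apply rcont_sum; intros. now apply continuous_cdot.
Qed.

Lemma continuous_node_dot (N : nat) (u v : R -> R -> C) (t : R) :
  (forall j, (j <= 2 * N - 1)%nat -> ccont (fun s => u s (node N j))) ->
  (forall j, (j <= 2 * N - 1)%nat -> ccont (fun s => v s (node N j))) ->
  continuous (fun s => node_dot N (u s) (v s)) t.
Proof.
  intros Hu Hv.
  apply (continuous_scal_r (V := R_NormedModule) (PI / INR N)).
  apply rcont_sum; intros. apply continuous_cdot; auto.
Qed.

Lemma ccont_trig (N : nat) (c : R -> Z -> C) (x : R) :
  (forall k, ccont (fun s => c s k)) -> ccont (fun s => trig N (c s) x).
Proof.
  intros Hc. apply ccont_sum; intros.
  apply (ccont_mult (fun s => c s _) (fun _ => _)); [apply Hc|apply ccont_const].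
Qed.

Lemma ccont_dft (N : nat) (u : R -> R -> C) (k : Z) :
  (forall j, (j <= 2 * N - 1)%nat -> ccont (u (node N j))) ->
  ccont (fun s => dft N (fun x => u x s) k).
Proof.
  intros Hu. apply ccont_mult; [apply ccont_const|].
  apply ccont_sum; intros.
  apply ccont_mult; [now apply Hu|apply ccont_const].
Qed.

Lemma ccont_dcoef (c : R -> Z -> C) (k : Z) :
  (forall k, ccont (fun s => c s k)) -> ccont (fun s => dcoef (c s) k).
Proof. intros Hc. apply ccont_mult; [apply ccont_const|apply Hc]. Qed.

Lemma is_cderive_unique (f : R -> C) (t : R) (l l' : C) :
  is_cderive f t l -> is_cderive f t l' -> l = l'.
Proof.
  intros [H1 H2] [H1' H2'].
  apply is_derive_unique in H1, H2, H1', H2'.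
  apply injective_projections; congruence.
Qed.

Lemma is_cderive_minus (f g : R -> C) (t : R) (l l' : C) :
  is_cderive f t l -> is_cderive g t l' ->
  is_cderive (fun s => (f s - g s)%C) t (l - l')%C.
Proof.
  intros [Hf1 Hf2] [Hg1 Hg2]; split;
    now apply (is_derive_minus (V := R_NormedModule)).
Qed.

Lemma is_cderive_mult_l (a : C) (f : R -> C) (t : R) (l : C) :
  is_cderive f t l -> is_cderive (fun s => (a * f s)%C) t (a * l)%C.
Proof.
  intros [H1 H2]; split.
  - apply (is_derive_minus (V := R_NormedModule));
      now apply (is_derive_scal (fun s => _ (f s))).
  - apply (is_derive_plus (V := R_NormedModule));
      now apply (is_derive_scal (fun s => _ (f s))).
Qed.

Lemma is_cderive_mult_r (a : C) (f : R -> C) (t : R) (l : C) :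
  is_cderive f t l -> is_cderive (fun s => (f s * a)%C) t (l * a)%C.
Proof.
  intros H. rewrite Cmult_comm.
  replace (fun s => (f s * a)%C) with (fun s => (a * f s)%C)
    by (apply functional_extensionality; intros; ring).
  now apply is_cderive_mult_l.
Qed.

Lemma is_cderive_sum (f : nat -> R -> C) (n : nat) (t : R) (l : nat -> C) :
  (forall m, (m <= n)%nat -> is_cderive (f m) t (l m)) ->
  is_cderive (fun s => sum_n (fun m => f m s) n) t (sum_n l n).
Proof.
  intros H; split.
  - rewrite csum_fst.
    apply (is_derive_ext (fun s => sum_n (fun m => fst (f m s)) n)).
    { intros; now rewrite csum_fst. }
    apply (is_derive_sum_n (V := R_NormedModule) (fun m s => fst (f m s))).
    intros; now apply H.
  - rewrite csum_snd.
    apply (is_derive_ext (fun s => sum_n (fun m => snd (f m s)) n)).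
    { intros; now rewrite csum_snd. }
    apply (is_derive_sum_n (V := R_NormedModule) (fun m s => snd (f m s))).
    intros; now apply H.
Qed.

Lemma is_cderive_dft (N : nat) (u u' : R -> R -> C) (k : Z) (t : R) :
  (forall j, (j <= 2 * N - 1)%nat ->
     is_cderive (u (node N j)) t (u' (node N j) t)) ->
  is_cderive (fun s => dft N (fun x => u x s) k) t (dft N (fun x => u' x t) k).
Proof.
  intros Hu. apply is_cderive_mult_l.
  apply (is_cderive_sum (fun j s => (u (node N j) s * expi (- k) (node N j))%C)).
  intros; now apply is_cderive_mult_r, Hu.
Qed.

Lemma is_cderive_trig (N : nat) (c c' : R -> Z -> C) (x t : R) :
  (forall k, is_cderive (fun s => c s k) t (c' t k)) ->
  is_cderive (fun s => trig N (c s) x) t (trig N (c' t) x).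
Proof.
  intros Hc.
  apply (is_cderive_sum (fun m s => (c s (freq N m) * expi (freq N m) x)%C)).
  intros; now apply (is_cderive_mult_r _ (fun s => c s _)).
Qed.

Lemma is_derive_coef_dot (N : nat) (c c' : R -> Z -> C) (t : R) :
  (forall k, is_cderive (fun s => c s k) t (c' t k)) ->
  is_derive (fun s => coef_dot N (c s) (c s)) t (2 * coef_dot N (c t) (c' t)).
Proof.
  intros Hc. unfold coef_dot.
  replace (2 * (2 * PI * _)) with (2 * PI * sum_n (fun m =>
    2 * cdot (c t (freq N m)) (c' t (freq N m))) (2 * N - 1))
    by (rewrite rsum_scal; ring).
  apply (is_derive_scal (fun s => sum_n (fun m =>
    cdot (c s (freq N m)) (c s (freq N m))) (2 * N - 1))).
  apply (is_derive_sum_n (V := R_NormedModule)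
    (fun m s => cdot (c s (freq N m)) (c s (freq N m)))).
  intros m _. destruct (Hc (freq N m)) as [H1 H2].
  unfold cdot. evar_last.
  - apply (is_derive_plus (V := R_NormedModule));
      apply (is_derive_mult (K := R_AbsRing)); eassumption || exact Rmult_comm.
  - simpl. unfold plus, mult; simpl. ring.
Qed.

(** * Extension in time beyond [[0, T]] *)

(** [[a, b]] is a neighbourhood of an interior point, so restricting the filter to it loses nothing.
    The second function [g] lets the derivative be transferred to an extension of [f]. *)
Lemma is_derive_on_interior (a b : R) (f g : R -> C) (t : R) (l : C) :
  (forall s, a <= s <= b -> f s = g s) ->
  a < t < b -> is_derive_on a b f t l -> is_cderive g t l.
Proof.
  intros Hfg Ht H.
  assert (Hloc : locally t (fun s => a <= s <= b)).
  { apply (locally_interval _ t a b); simpl; intros; lra. }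
  assert (Hd : is_derive (V := C_R_NormedModule) g t l).
  { apply (is_derive_ext_loc (V := C_R_NormedModule) f).
    { revert Hloc; apply filter_imp; auto. }
    destruct H as [Hlin Hdom]; split; [exact Hlin|].
    intros x Hx eps.
    (* [filterdiff] quantifies over every limit point of its filter; [locally t] has only [t]. *)
    assert (x = t) as ->.
    { symmetry. now apply (is_filter_lim_locally_unique (V := R_NormedModule)). }
    assert (Hx' : is_filter_lim (within (fun s => a <= s <= b) (locally t)) t).
    { intros P HP. now apply filter_le_within. }
    specialize (Hdom t Hx' eps).
    generalize (filter_and _ _ Hloc Hdom). apply filter_imp. intuition. }
  split.
  - apply (filterdiff_comp' g fst t (fun h => scal h l) fst) in Hd; [exact Hd|].
    exact (filterdiff_linear _ (is_linear_fst (U := R_NormedModule) (V := R_NormedModule))).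
  - apply (filterdiff_comp' g snd t (fun h => scal h l) snd) in Hd; [exact Hd|].
    exact (filterdiff_linear _ (is_linear_snd (U := R_NormedModule) (V := R_NormedModule))).
Qed.

Definition clamp (T t : R) : R := Rmax 0 (Rmin t T).

Lemma clamp_range (T t : R) : 0 <= T -> 0 <= clamp T t <= T.
Proof. intros HT. unfold clamp, Rmax, Rmin. repeat destruct Rle_dec; lra. Qed.

Lemma clamp_id (T t : R) : 0 <= t <= T -> clamp T t = t.
Proof. intros Ht. unfold clamp, Rmax, Rmin. repeat destruct Rle_dec; lra. Qed.

Lemma clamp_contraction (T s t : R) : Rabs (clamp T s - clamp T t) <= Rabs (s - t).
Proof.
  unfold clamp, Rmax, Rmin, Rabs.
  repeat (destruct Rle_dec || destruct Rcase_abs); lra.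
Qed.

Lemma ccont_clamp (T x : R) (D : R -> R -> C) :
  0 <= T -> 0 <= x <= 2 * PI ->
  continuous_on (rect T) (fun p : R * R => D (fst p) (snd p)) ->
  ccont (fun t => D x (clamp T t)).
Proof.
  intros HT Hx HD t.
  assert (H : filterlim (fun s => D x (clamp T s)) (locally t)
                (locally (D x (clamp T t)))).
  { apply (filterlim_comp _ _ _ (fun s => (x, clamp T s))
      (fun p : R * R => D (fst p) (snd p)) _
      (within (rect T) (locally (x, clamp T t)))).
    (* The radius is kept because [clamp] is 1-Lipschitz, and the image stays in [rect T], so
       continuity relative to the rectangle is enough. *)
    - intros P [eps HP]. exists eps. intros s Hs. apply HP.
      + split; [apply ball_center|].
        apply Rle_lt_trans with (2 := Hs). apply clamp_contraction.
      + split; [exact Hx|]. now apply clamp_range.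
    - apply HD. split; [exact Hx|]. now apply clamp_range. }
  split.
  - apply (filterlim_comp _ _ _ (fun s => D x (clamp T s)) fst _ _ _ H).
    rewrite (surjective_pairing (D x (clamp T t))). apply continuous_fst.
  - apply (filterlim_comp _ _ _ (fun s => D x (clamp T s)) snd _ _ _ H).
    rewrite (surjective_pairing (D x (clamp T t))). apply continuous_snd.
Qed.

(** [V1] and [V1'] extend [V] and its time derivative beyond [[0, T]] by their
    endpoint values, so that they are continuous in time on the whole line;
    one-sided derivatives are then never needed. *)
Lemma smooth_time_extension (T : R) (V : R -> R -> C) :
  0 < T -> smooth T V ->
  exists V1 V1' : R -> R -> C,
    forall x, 0 <= x <= 2 * PI ->
      (forall t, 0 <= t <= T -> V1 x t = V x t) /\
      ccont (V1 x) /\ ccont (V1' x) /\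
      forall t, 0 < t < T -> is_cderive (V1 x) t (V1' x t).
Proof.
  intros HT [D [H0 HD]].
  exists (fun x t => D 0%nat 0%nat x (clamp T t)),
         (fun x t => D 0%nat 1%nat x (clamp T t)).
  intros x Hx. split; [|split; [|split]].
  - intros t Ht. rewrite clamp_id by easy. now apply H0.
  - apply (ccont_clamp T x (D 0%nat 0%nat)); [lra|easy|apply HD].
  - apply (ccont_clamp T x (D 0%nat 1%nat)); [lra|easy|apply HD].
  - intros t Ht. rewrite clamp_id by lra.
    apply (is_derive_on_interior 0 T (fun s => D 0%nat 0%nat x s)); trivial.
    + intros s Hs. now rewrite clamp_id.
    + apply HD. split; simpl; lra.
Qed.

(** * The nodal residual in terms of coefficients *)

Lemma sup_norm_ge (u : R -> C) (M x : R) :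
  Rbar_le (sup_norm u) M -> 0 <= x <= 2 * PI -> Cmod (u x) <= M.
Proof.
  intros HM Hx.
  destruct (Lub_Rbar_correct (fun r => exists x, 0 <= x <= 2 * PI /\ r = Cmod (u x)))
    as [Hub _].
  apply (Rbar_le_trans (Cmod (u x)) (sup_norm u) M); [|exact HM].
  apply Hub. now exists x.
Qed.

Lemma dft_ext (N : nat) (u v : R -> C) (k : Z) :
  (forall j, (j <= 2 * N - 1)%nat -> u (node N j) = v (node N j)) ->
  dft N u k = dft N v k.
Proof.
  intros H. unfold dft. f_equal. apply sum_n_ext_loc; intros.
  now rewrite H.
Qed.

(** Because of the square this function can leave [S_N]; it is compared with [F] and [G] at the
    nodes only. *)
Definition residual (A B Cc : R) (N : nat) (c c' : Z -> C) (x : R) : C :=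
  (trig N c' x - RtoC A * trig N (dcoef (dcoef c)) x
   - RtoC B * trig N (dcoef c) x
   - RtoC Cc * (trig N (dcoef c) x * trig N (dcoef c) x))%C.

Lemma ccont_residual (A B Cc : R) (N : nat) (c c' : R -> Z -> C) (x : R) :
  (forall k, ccont (fun s => c s k)) -> (forall k, ccont (fun s => c' s k)) ->
  ccont (fun s => residual A B Cc N (c s) (c' s) x).
Proof.
  intros Hc Hc'.
  assert (Hd : forall k, ccont (fun s => dcoef (c s) k))
    by (intros; now apply ccont_dcoef).
  assert (Hx : ccont (fun s => trig N (dcoef (c s)) x))
    by now apply (ccont_trig N (fun s => dcoef (c s))).
  apply ccont_minus; [apply ccont_minus; [apply ccont_minus|]|].
  - now apply ccont_trig.
  - apply ccont_mult; [apply ccont_const|].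
    apply (ccont_trig N (fun s => dcoef (dcoef (c s)))).
    intros k; now apply (ccont_dcoef (fun s => dcoef (c s))).
  - now apply ccont_mult; [apply ccont_const|].
  - apply ccont_mult; [apply ccont_const|]. now apply ccont_mult.
Qed.

(** The time derivative in [nodal_residual] is only asserted to exist. At interior times it is an
    ordinary derivative, and uniqueness identifies it with the interpolant of [V1'], since the
    transform is linear with fixed nodes. *)
Lemma nodal_residual_interior (A B Cc T : R) (N : nat) (V F V1 V1' : R -> R -> C)
  (t : R) (j : nat) :
  (1 <= N)%nat -> (j <= 2 * N - 1)%nat -> 0 < t < T ->
  nodal_residual A B Cc T N (interp_x N V) F ->
  (forall x, 0 <= x <= 2 * PI ->
     (forall t, 0 <= t <= T -> V1 x t = V x t) /\
     forall t, 0 < t < T -> is_cderive (V1 x) t (V1' x t)) ->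
  F (node N j) t =
    residual A B Cc N (dft N (fun x => V1 x t)) (dft N (fun x => V1' x t))
      (node N j).
Proof.
  intros HN Hj Ht HF HV.
  assert (Hc : forall s, 0 <= s <= T ->
    (fun x => interp_x N V x s) = trig N (dft N (fun x => V1 x s))).
  { intros s Hs. apply functional_extensionality; intros x.
    apply sum_n_ext; intros m. f_equal.
    apply dft_ext; intros i Hi. symmetry.
    apply HV; [now apply node_range|easy]. }
  destruct (HF t) as [_ HFj]; [lra|].
  destruct (HFj j) as [vtau [Hvtau ->]]; [lia|].
  rewrite Hc, !CDerive_trig by lra. unfold residual. do 3 f_equal.
  apply (is_derive_on_interior 0 T _
    (fun s => trig N (dft N (fun x => V1 x s)) (node N j)) t) in Hvtau; trivial.
  - apply (is_cderive_unique _ _ _ _ Hvtau).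
    apply (is_cderive_trig N (fun s => dft N (fun x => V1 x s))
      (fun s => dft N (fun x => V1' x s))).
    intros k. apply is_cderive_dft. intros i Hi.
    apply HV; [now apply node_range|easy].
  - intros s Hs. now rewrite <- Hc.
Qed.

(** * The stability estimate, with a constant uniform in [N] *)

Theorem theorem4p1
  (alpha sigma xmin xmax kappa A B Cc T M : R)
  (hsigma : 0 < sigma) (hx : xmin < xmax)
  (hkappa : kappa = kappa_of xmin xmax)
  (hA : A = kappa ^ 2 * (sigma ^ 2 / 2))
  (hB : B = kappa * (alpha - sigma ^ 2 / 2))
  (hC : Cc = kappa ^ 2 * (sigma ^ 2 / 2))
  (hT : 0 < T) (hM : 0 <= M) :
  exists R0 : R,
  forall (N : nat) (V W F G : R -> R -> C),
    (1 <= N)%nat ->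
    smooth T V -> periodic_x T V ->
    smooth T W -> periodic_x T W ->
    let VN := interp_x N V in
    let WN := interp_x N W in
    nodal_residual A B Cc T N VN F ->
    nodal_residual A B Cc T N WN G ->
    (forall tau, 0 <= tau <= T ->
       Rbar_le (sup_norm (CDerive (fun x => VN x tau))) M /\
       Rbar_le (sup_norm (CDerive (fun x => WN x tau))) M) ->
    let e := fun tau x => (VN x tau - WN x tau)%C in
    let J := fun tau x => (F x tau - G x tau)%C in
    exists emax : R,
      is_max_on (fun tau => L2norm (e tau) ^ 2) 0 T emax /\
      emax + A / 2 * RInt (fun tau => L2norm (CDerive (e tau)) ^ 2) 0 T
        <= R0 * (L2norm (e 0) ^ 2 + RInt (fun tau => L2norm (J tau) ^ 2) 0 T).
Proof.
  assert (HAC : Cc = A) by congruence.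
  assert (HA : 0 < A).
  { rewrite hA. apply Rmult_lt_0_compat; [|nra].
    apply pow_lt. rewrite hkappa. unfold kappa_of.
    apply Rdiv_lt_0_compat; [|lra]. generalize PI_RGT_0; lra. }
  set (K := 4 * M ^ 2 * A + 1).
  assert (HK : 0 <= K) by (unfold K; generalize (pow2_ge_0 M); nra).
  (* The maximum and the integral are bounded through the Gronwall estimate at two different times,
     the maximiser and [T]; adding the two bounds gives the factor [2]. *)
  exists (2 * exp (K * T)).
  intros N V W F G HN HV _ HW _ VN WN HF HG HM e J.
  destruct (smooth_time_extension T V hT HV) as [V1 [V1' HV1]].
  destruct (smooth_time_extension T W hT HW) as [W1 [W1' HW1]].
  set (cV := fun t => dft N (fun x => V1 x t)).
  set (cV' := fun t => dft N (fun x => V1' x t)).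
  set (cW := fun t => dft N (fun x => W1 x t)).
  set (cW' := fun t => dft N (fun x => W1' x t)).
  set (c := fun t k => (cV t k - cW t k)%C).
  set (c' := fun t k => (cV' t k - cW' t k)%C).
  assert (HVN : forall t, 0 <= t <= T -> (fun x => VN x t) = trig N (cV t)).
  { intros t Ht. apply functional_extensionality; intros x.
    apply sum_n_ext; intros m. f_equal. apply dft_ext; intros i Hi.
    symmetry. apply HV1; [now apply node_range|easy]. }
  assert (HWN : forall t, 0 <= t <= T -> (fun x => WN x t) = trig N (cW t)).
  { intros t Ht. apply functional_extensionality; intros x.
    apply sum_n_ext; intros m. f_equal. apply dft_ext; intros i Hi.
    symmetry. apply HW1; [now apply node_range|easy]. }
  assert (He : forall t, 0 <= t <= T -> e t = trig N (c t)).
  { intros t Ht. apply functional_extensionality; intros x.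
    unfold e, c. rewrite trig_minus, <- HVN, <- HWN by easy. reflexivity. }
  assert (CV : forall k, ccont (fun t => cV t k)).
  { intros k. apply ccont_dft; intros. now apply HV1, node_range. }
  assert (CV' : forall k, ccont (fun t => cV' t k)).
  { intros k. apply ccont_dft; intros. now apply HV1, node_range. }
  assert (CW : forall k, ccont (fun t => cW t k)).
  { intros k. apply ccont_dft; intros. now apply HW1, node_range. }
  assert (CW' : forall k, ccont (fun t => cW' t k)).
  { intros k. apply ccont_dft; intros. now apply HW1, node_range. }
  assert (Cc_cont : forall k, ccont (fun t => c t k))
    by (intros; now apply ccont_minus).
  assert (dc : forall t, 0 < t < T -> forall k,
    is_cderive (fun s => c s k) t (c' t k)).
  { intros t Ht k. apply is_cderive_minus; apply is_cderive_dft; intros.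
    - apply HV1; [now apply node_range|easy].
    - apply HW1; [now apply node_range|easy]. }
  (* [JN] is built from the extended coefficients, so [j] below is continuous on the whole line, as
     [gronwall] requires. It is identified with [||J||^2] for [0 < t < T]. *)
  set (JN := fun t x =>
    (residual A B Cc N (cV t) (cV' t) x - residual A B Cc N (cW t) (cW' t) x)%C).
  set (E := fun t => coef_dot N (c t) (c t)).
  set (D := fun t => coef_dot N (dcoef (c t)) (dcoef (c t))).
  set (j := fun t => node_dot N (JN t) (JN t)).
  (* [J] lies in [S_N] and shares its nodal values with [JN]; Parseval applied to [J] then turns
     [||J||^2] into the nodal sum [j]. *)
  assert (HJ : forall t, 0 < t < T -> exists d, J t = trig N d /\
    forall i, (i <= 2 * N - 1)%nat -> trig N d (node N i) = JN t (node N i)).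
  { intros t Ht.
    destruct (HF t) as [[cF HcF] _]; [lra|]. destruct (HG t) as [[cG HcG] _]; [lra|].
    exists (fun k => (cF k - cG k)%C).
    assert (HJt : J t = trig N (fun k => (cF k - cG k)%C)).
    { apply functional_extensionality; intros x.
      unfold J. rewrite trig_minus, HcF, HcG. reflexivity. }
    split; [exact HJt|]. intros i Hi. rewrite <- HJt.
    unfold J, JN. f_equal; [|f_equal].
    - apply (nodal_residual_interior _ _ _ T _ V); trivial.
      intros x Hx. split; now apply HV1.
    - apply (nodal_residual_interior _ _ _ T _ W); trivial.
      intros x Hx. split; now apply HW1. }
  assert (Hj : forall t d,
    (forall i, (i <= 2 * N - 1)%nat -> trig N d (node N i) = JN t (node N i)) ->
    coef_dot N d d = j t).
  { intros t d Hd. rewrite <- parseval_nodes by easy.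
    unfold j, node_dot. f_equal. apply sum_n_ext_loc; intros i Hi.
    now rewrite Hd. }
  assert (E_cont : forall t, continuous E t)
    by (intros; now apply continuous_coef_dot).
  assert (D_cont : forall t, continuous D t).
  { intros. apply (continuous_coef_dot N (fun s => dcoef (c s)) (fun s => dcoef (c s)));
      intros; now apply ccont_dcoef. }
  assert (j_cont : forall t, continuous j t).
  { intros. apply continuous_node_dot; intros;
      apply ccont_minus; now apply ccont_residual. }
  assert (D_ge_0 : forall t, 0 <= D t) by (intros; now apply coef_dot_ge_0).
  assert (j_ge_0 : forall t, 0 <= j t).
  { intros t. apply Rmult_le_pos.
    - apply Rdiv_le_0_compat; [generalize PI_RGT_0; lra|]. apply lt_0_INR; lia.
    - apply rsum_ge_0; intros; apply cdot_ge_0. }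
  assert (E_ge_0 : forall t, 0 <= E t) by (intros; now apply coef_dot_ge_0).
  assert (Hineq : forall t, 0 < t < T ->
    2 * coef_dot N (c t) (c' t) + A * D t <= K * E t + j t).
  { intros t Ht. destruct (HJ t Ht) as [d [_ Hd]].
    rewrite <- (Hj t d Hd).
    (* The multiplier comes from [(V^N_x)^2 - (W^N_x)^2 = (V^N_x + W^N_x) e_x]; each summand is at
       most [M] in modulus, whence [2 M]. *)
    apply (energy_inequality N A B M (c t) (c' t) d (fun i =>
      trig N (dcoef (cV t)) (node N i) + trig N (dcoef (cW t)) (node N i))%C);
      trivial; [lra| |].
    - intros i Hi. eapply Rle_trans; [apply Cmod_triangle|].
      destruct (HM t) as [HMV HMW]; [lra|].
      apply (sup_norm_ge _ _ (node N i)) in HMV, HMW; try now apply node_range.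
      rewrite HVN, CDerive_trig in HMV by lra.
      rewrite HWN, CDerive_trig in HMW by lra. lra.
    - intros i Hi. rewrite Hd by easy. unfold JN, residual, c, c'.
      rewrite HAC, !dcoef_minus, !trig_minus. ring. }
  assert (Hgr := gronwall E (fun t => 2 * coef_dot N (c t) (c' t)) D j A K T
    (Rlt_le _ _ HA) HK E_cont D_cont j_cont D_ge_0 j_ge_0
    (fun t Ht => is_derive_coef_dot N c c' t (dc t Ht)) Hineq).
  assert (HL2 : forall t, 0 <= t <= T -> L2norm (e t) ^ 2 = E t)
    by (intros; rewrite He by easy; now apply L2norm_trig).
  rewrite (RInt_ext _ D).
  2:{ rewrite Rmin_left, Rmax_right by lra. intros t Ht.
      rewrite He, CDerive_trig by lra. now apply L2norm_trig. }
  (* [RInt_ext] compares integrands on the open interval only, which is where [J] has been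
     identified. *)
  rewrite (RInt_ext (fun t => L2norm (J t) ^ 2) j).
  2:{ rewrite Rmin_left, Rmax_right by lra. intros t Ht.
      destruct (HJ t Ht) as [d [-> Hd]].
      rewrite L2norm_trig by easy. now apply Hj. }
  rewrite HL2 by lra.
  assert (ex_j : forall a b, ex_RInt j a b).
  { intros. apply (ex_RInt_continuous (V := R_CompleteNormedModule)). auto. }
  assert (ex_D : forall a b, ex_RInt D a b).
  { intros. apply (ex_RInt_continuous (V := R_CompleteNormedModule)). auto. }
  (* The right-hand side is made independent of [t] by enlarging [exp (K t)] and the integral of
     [j >= 0] to their values at [T]. *)
  assert (Hbound : forall t, 0 <= t <= T ->
    E t + A * RInt D 0 t <= exp (K * T) * (E 0 + RInt j 0 T)).
  { intros t Ht. apply Rle_trans with (1 := Hgr t Ht).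
    assert (0 <= RInt j 0 t) by (apply RInt_ge_0; auto; lra).
    assert (0 <= RInt j t T) by (apply RInt_ge_0; auto; lra).
    assert (RInt j 0 t + RInt j t T = RInt j 0 T)
      by now apply (RInt_Chasles (V := R_CompleteNormedModule)).
    apply Rmult_le_compat; try lra.
    - left; apply exp_pos.
    - generalize (E_ge_0 0); lra.
    - destruct (Req_dec t T) as [->|]; [lra|].
      left; apply exp_increasing. assert (0 < K); [|nra].
      unfold K; generalize (pow2_ge_0 M); nra. }
  destruct (continuity_ab_maj E 0 T) as [tmax [Hmax Htmax]]; [lra| |].
  { intros t _. apply continuity_pt_filterlim, E_cont. }
  exists (E tmax). split.
  - split.
    + exists tmax. split; [easy|]. now apply HL2.
    + intros t Ht. rewrite HL2 by easy. now apply Hmax.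
  - assert (H1 := Hbound tmax Htmax).
    assert (H2 := Hbound T ltac:(lra)).
    assert (0 <= RInt D 0 tmax) by (apply RInt_ge_0; auto; lra).
    assert (0 <= RInt D 0 T) by (apply RInt_ge_0; auto; lra).
    generalize (E_ge_0 T). nra.
Qed.
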